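(* Let $\lambda$ be a nonzero real parameter and $x$ a variable. For integers $1\le k\le n$, \[ S_{2,\lambda}(n+1,k\mid x)=(x+k)S_{2,\lambda}(n,k\mid x)+S_{2,\lambda}(n,k-1\mid x)-n\lambda\, S_{2,\lambda}(n,k\mid x). \]
   Context: The degenerate Stirling polynomials of the second kind $S_{2,\lambda}(n,k\mid x)$ ($n,k\ge0$) are defined by the generating function \[ \frac{1}{k!}(1+\lambda t)^{x/\lambda}\big((1+\lambda t)^{1/\lambda}-1\big)^k=\sum_{n=k}^{\infty}S_{2,\lambda}(n,k\mid x)\frac{t^n}{n!}. \] *)

(* Defs.v *)
From Stdlib Require Import Factorial Reals ClassicalEpsilon.
From Coquelicot Require Import Coquelicot.
Open Scope R_scope.

(* [Rpower] is the real power only for a positive base; below the base is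
   [1 + lam * t] with [t] close to 0. *)
Definition gen_fun (lam : R) (k : nat) (x t : R) : R :=
  / INR (fact k) * Rpower (1 + lam * t) (x / lam)
    * (Rpower (1 + lam * t) (1 / lam) - 1) ^ k.

(* The sum over n >= k is indexed by n = k + m.  The generating function only
   mentions the coefficients with n >= k; the others are 0, so that [a] is
   uniquely determined. *)
Definition gen_fun_coeffs (lam : R) (k : nat) (x : R) (a : nat -> R) : Prop :=
  (forall n : nat, (n < k)%nat -> a n = 0) /\
  locally 0 (fun t : R =>
    is_series (fun m : nat => a (k + m)%nat * (t ^ (k + m) / INR (fact (k + m))))
              (gen_fun lam k x t)).

(* S_{2,lam}(n, k | x) *)
Definition S2 (lam : R) (n k : nat) (x : R) : R :=
  epsilon (inhabits (fun _ : nat => 0)) (gen_fun_coeffs lam k x) n.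

(* Main.v *)
Require Import Defs.
From Stdlib Require Import Reals Lra Lia Factorial ClassicalEpsilon.
From Coquelicot Require Import Coquelicot.
Open Scope R_scope.

(** Writing [F k x] for the generating function, the factor
    [(1 + lam t)^(1/lam) - 1] gives
    [(k + 1) * F (k + 1) x = F k (x + 1) - F k x].  Hence the coefficients are
    iterated differences of the degenerate falling factorials, which are the
    coefficients of [F 0 x = (1 + lam t)^(x/lam)] by the binomial series.  The
    recurrence in [n] holds for the degenerate falling factorials and is
    inherited by their differences. *)

(** * Differences of degenerate falling factorials and their recurrence *)

Fixpoint degenerate_ffact (lam x : R) (n : nat) : R :=
  match n with
  | O => 1
  | S m => (x - INR m * lam) * degenerate_ffact lam x m
  end.

Fixpoint stirling2 (lam : R) (k : nat) (x : R) (n : nat) : R :=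
  match k with
  | O => degenerate_ffact lam x n
  | S j => / INR (S j) * (stirling2 lam j (x + 1) n - stirling2 lam j x n)
  end.

Lemma stirling2_rec_0 (lam x : R) (n : nat) :
  stirling2 lam 0 x (S n) = (x - INR n * lam) * stirling2 lam 0 x n.
Proof. reflexivity. Qed.

(** Induction on [k] for all [x]. In the difference in [x] of the recurrence one level below, the
    multiplier grows by 1 with the shift, leaving one extra copy of the lower value; the remaining
    terms differ by [INR (S k)] more copies. Division by [INR (S (S k))] leaves exactly one. *)
Lemma stirling2_rec (lam : R) (k : nat) (x : R) (n : nat) :
  stirling2 lam (S k) x (S n) =
    (x + INR (S k) - INR n * lam) * stirling2 lam (S k) x n + stirling2 lam k x n.
Proof.
assert (step : forall j y m, stirling2 lam (S j) y m =
  / INR (S j) * (stirling2 lam j (y + 1) m - stirling2 lam j y m)) by reflexivity.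
revert x; induction k as [|k IH]; intros x.
- rewrite !step, !stirling2_rec_0; simpl INR; field.
- rewrite (step (S k) x (S n)), !IH, !(step (S k) x n).
  rewrite (step k (x + 1) n), (step k x n), !S_INR.
  pose proof (pos_INR k); field; lra.
Qed.

(** At [n = 0] the falling factorial is constant in [x], so every difference vanishes; the
    recurrence carries this to larger [n]. *)
Lemma stirling2_small (lam : R) (k : nat) (x : R) (n : nat) :
  (n < k)%nat -> stirling2 lam k x n = 0.
Proof.
revert k x; induction n as [|n IH]; intros k x Hnk.
- revert x; induction k as [|k IHk]; intros x; [lia|]; simpl stirling2.
  destruct k as [|k]; [simpl; ring|].
  rewrite !IHk by lia; ring.
- destruct k as [|k]; [lia|].
  rewrite stirling2_rec, !IH by lia; ring.
Qed.

(** * Convergence radii and uniqueness of coefficients *)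

Lemma CV_radius_pos_bounded (a : nat -> R) (r M : R) :
  0 < r -> (forall n, Rabs (a n * r ^ n) <= M) -> Rbar_lt 0 (CV_radius a).
Proof.
intros r_gt0 HM.
apply Rbar_lt_le_trans with (Finite r); [exact r_gt0|].
apply (proj1 (CV_radius_bounded a)); exists M; exact HM.
Qed.

(** Convergence at the single point [eps / 2] suffices: there the terms tend to 0, which fails
    outside the closed disk of convergence. *)
Lemma CV_radius_pos_locally (a : nat -> R) (f : R -> R) :
  locally 0 (fun t => is_pseries a t (f t)) -> Rbar_lt 0 (CV_radius a).
Proof.
intros [eps Heps].
pose proof (cond_pos eps) as eps_gt0.
assert (Hball : ball 0 eps (eps / 2)).
{ change (Rabs (eps / 2 - 0) < eps); rewrite Rabs_pos_eq; lra. }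
apply Rbar_lt_le_trans with (Finite (Rabs (eps / 2))).
{ simpl; rewrite Rabs_pos_eq; lra. }
apply Rbar_not_lt_le; intros Hlt.
apply (CV_disk_outside _ _ Hlt), ex_series_lim_0.
eexists; apply is_pseries_R, Heps, Hball.
Qed.

Lemma locally_pseries_unique (a b : nat -> R) (f : R -> R) :
  locally 0 (fun t => is_pseries a t (f t)) ->
  locally 0 (fun t => is_pseries b t (f t)) ->
  forall n, a n = b n.
Proof.
intros Ha Hb n.
apply PSeries_ext_recip.
- exact (CV_radius_pos_locally _ _ Ha).
- exact (CV_radius_pos_locally _ _ Hb).
- generalize (filter_and _ _ Ha Hb); apply filter_imp; intros t [Hat Hbt].
  now rewrite (is_pseries_unique _ _ _ Hat), (is_pseries_unique _ _ _ Hbt).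
Qed.

(** * The binomial series *)

Definition egf (a : nat -> R) (n : nat) : R := a n / INR (fact n).

Lemma egf_ffact_S (lam x : R) (n : nat) :
  INR (S n) * egf (degenerate_ffact lam x) (S n) =
    (x - INR n * lam) * egf (degenerate_ffact lam x) n.
Proof.
unfold egf; rewrite fact_simpl, mult_INR; simpl degenerate_ffact.
field; split; [apply INR_fact_neq_0|apply not_0_INR; lia].
Qed.

(** The ratio of consecutive coefficients, [(x - INR n * lam) / INR (S n)], is at most
    [Rabs x + Rabs lam] in absolute value, so the terms at [/ B] stay bounded by 1. The summand 1 in
    [B] keeps it positive even if [x] and [lam] vanish. *)
Lemma CV_radius_binomial (lam x : R) :
  Rbar_lt 0 (CV_radius (egf (degenerate_ffact lam x))).
Proof.
set (B := Rabs x + Rabs lam + 1).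
assert (HB : 0 < B).
{ unfold B; pose proof (Rabs_pos x); pose proof (Rabs_pos lam); lra. }
apply CV_radius_pos_bounded with (/ B) 1; [now apply Rinv_0_lt_compat|].
induction n as [|n IH].
- unfold egf; simpl; rewrite Rabs_pos_eq; lra.
- assert (Hn : 0 < INR (S n)) by (apply lt_0_INR; lia).
  assert (Hr : egf (degenerate_ffact lam x) (S n) * (/ B) ^ S n =
    ((x - INR n * lam) / (INR (S n) * B))
      * (egf (degenerate_ffact lam x) n * (/ B) ^ n)).
  { replace (egf (degenerate_ffact lam x) (S n)) with
      ((x - INR n * lam) * egf (degenerate_ffact lam x) n / INR (S n)).
    - simpl pow; field; lra.
    - rewrite <- egf_ffact_S; field; lra. }
  rewrite Hr, Rabs_mult, <- (Rmult_1_r 1).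
  apply Rmult_le_compat; try apply Rabs_pos; [|exact IH].
  unfold Rdiv; rewrite Rabs_mult, (Rabs_pos_eq (/ _)).
  2: { apply Rlt_le, Rinv_0_lt_compat, Rmult_lt_0_compat; lra. }
  apply Rmult_le_reg_r with (INR (S n) * B); [apply Rmult_lt_0_compat; lra|].
  rewrite Rmult_assoc, Rinv_l, Rmult_1_r, Rmult_1_l.
  2: { apply Rgt_not_eq, Rmult_lt_0_compat; lra. }
  apply Rle_trans with (Rabs x + INR n * Rabs lam).
  + eapply Rle_trans; [apply Rabs_triang|].
    rewrite Rabs_Ropp, Rabs_mult, (Rabs_pos_eq (INR n)) by apply pos_INR; lra.
  + rewrite S_INR; unfold B.
    pose proof (pos_INR n); pose proof (Rabs_pos x); pose proof (Rabs_pos lam); nra.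
Qed.

Lemma binomial_series_ode (lam x t : R) :
  Rbar_lt (Rabs t) (CV_radius (egf (degenerate_ffact lam x))) ->
  (1 + lam * t) * PSeries (PS_derive (egf (degenerate_ffact lam x))) t =
    x * PSeries (egf (degenerate_ffact lam x)) t.
Proof.
set (b := egf (degenerate_ffact lam x)); intros Ht.
(* The coefficient recurrence, read as f' = x f - lam t f'; [PS_incr_1] is multiplication by t. *)
assert (HE : PSeries (PS_derive b) t =
  PSeries (PS_plus (PS_scal x b) (PS_scal (- lam) (PS_incr_1 (PS_derive b)))) t).
{ apply PSeries_ext; intros n.
  pose proof (egf_ffact_S lam x n) as Hn; fold b in Hn.
  unfold PS_plus, PS_scal; unfold PS_derive at 1; rewrite Hn.
  change plus with Rplus; change scal with Rmult.
  destruct n as [|n]; unfold PS_incr_1.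
  - change zero with 0; simpl; ring.
  - unfold PS_derive; ring. }
rewrite PSeries_plus, !PSeries_scal, PSeries_incr_1 in HE.
- lra.
- apply (ex_pseries_scal (V := R_NormedModule)); [apply Rmult_comm|].
  now apply CV_radius_inside.
- apply (ex_pseries_scal (V := R_NormedModule)); [apply Rmult_comm|].
  apply CV_radius_inside; now rewrite CV_radius_incr_1, CV_radius_derive.
Qed.

Lemma binomial_series (lam x : R) : lam <> 0 ->
  locally 0 (fun t => is_pseries (egf (degenerate_ffact lam x)) t
                                 (Rpower (1 + lam * t) (x / lam))).
Proof.
intros hlam.
set (b := egf (degenerate_ffact lam x)).
assert (Hr : exists r : posreal, Rbar_le r (CV_radius b)).
{ pose proof (CV_radius_binomial lam x) as H; fold b in H.
  destruct (CV_radius b) as [r| |]; simpl in H.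
  - exists (mkposreal r H); apply Rle_refl.
  - exists (mkposreal 1 Rlt_0_1); exact I.
  - contradiction. }
destruct Hr as [r Hr].
assert (Hlam : 0 < Rabs lam) by now apply Rabs_pos_lt.
(* Within [r] the series converges; within [/ Rabs lam] the base [1 + lam * t] stays positive. *)
assert (Heps : 0 < Rmin r (/ Rabs lam)).
{ apply Rmin_pos; [apply cond_pos|now apply Rinv_0_lt_compat]. }
exists (mkposreal _ Heps); intros t Ht.
change (Rabs (t - 0) < Rmin r (/ Rabs lam)) in Ht; rewrite Rminus_0_r in Ht.
assert (Hin : forall s, Rabs s <= Rabs t ->
  Rbar_lt (Rabs s) (CV_radius b) /\ 0 < 1 + lam * s).
{ intros s Hs; split.
  - apply Rbar_lt_le_trans with (Finite r); [|exact Hr].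
    simpl; pose proof (Rmin_l r (/ Rabs lam)); lra.
  - assert (Hls : Rabs (lam * s) < 1).
    { rewrite Rabs_mult, <- (Rinv_r (Rabs lam)) by lra.
      apply Rmult_lt_compat_l; [exact Hlam|].
      pose proof (Rmin_r r (/ Rabs lam)); lra. }
    apply Rabs_def2 in Hls; lra. }
destruct (Hin t (Rle_refl _)) as [HtR Htpos].
(* By the differential equation, the quotient of the sum of the series by the
   power is constant. *)
assert (Hcst : PSeries b t * exp (- (x / lam) * ln (1 + lam * t)) =
               PSeries b 0 * exp (- (x / lam) * ln (1 + lam * 0))).
{ apply Rminus_diag_uniq, Rabs_eq_0, Rle_antisym; [|apply Rabs_pos].
  (* Mean value inequality, with 0 as the bound on the derivative. *)
  eapply Rle_trans; [|apply Req_le, (Rmult_0_l (Rabs (t - 0)))].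
  apply (bounded_variation
    (fun s => PSeries b s * exp (- (x / lam) * ln (1 + lam * s))) (fun _ => 0)).
  intros s; rewrite !Rminus_0_r; intros Hs; split; [|rewrite Rabs_R0; lra].
  destruct (Hin s Hs) as [HsR Hspos].
  set (e := exp (- (x / lam) * ln (1 + lam * s))).
  replace 0 with (PSeries (PS_derive b) s * e
    + PSeries b s * (- (x / lam) * (lam / (1 + lam * s)) * e)).
  - apply (Derive.is_derive_mult (PSeries b)).
    + now apply is_derive_PSeries.
    + unfold e; auto_derive; [lra|field; lra].
  - pose proof (binomial_series_ode lam x s HsR) as Hode; fold b in Hode.
    replace (PSeries (PS_derive b) s) with (x * PSeries b s / (1 + lam * s)).
    + field; split; lra.
    + rewrite <- Hode; field; lra. }
assert (Hb0 : PSeries b 0 = 1).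
{ rewrite PSeries_0; unfold b, egf; simpl; lra. }
rewrite Hb0, Rmult_0_r, Rplus_0_r, ln_1, Rmult_0_r, exp_0, Rmult_1_r in Hcst.
replace (Rpower (1 + lam * t) (x / lam)) with (PSeries b t).
{ now apply PSeries_correct, CV_radius_inside. }
apply (Rmult_eq_reg_r (exp (- (x / lam) * ln (1 + lam * t)))).
2: { apply Rgt_not_eq, exp_pos. }
rewrite Hcst; unfold Rpower; rewrite <- exp_plus, <- exp_0.
f_equal; ring.
Qed.

(** * Expansion of the generating function *)

Lemma gen_fun_S (lam : R) (k : nat) (x t : R) : lam <> 0 ->
  gen_fun lam (S k) x t =
    / INR (S k) * (gen_fun lam k (x + 1) t - gen_fun lam k x t).
Proof.
intros hlam; unfold gen_fun.
replace ((x + 1) / lam) with (x / lam + 1 / lam) by (field; exact hlam).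
rewrite Rpower_plus, fact_simpl, mult_INR, <- tech_pow_Rmult.
field; split; [apply INR_fact_neq_0|apply not_0_INR; lia].
Qed.

Lemma gen_fun_pseries (lam : R) (k : nat) (x : R) : lam <> 0 ->
  locally 0 (fun t => is_pseries (egf (stirling2 lam k x)) t (gen_fun lam k x t)).
Proof.
intros hlam; revert x; induction k as [|k IH]; intros x.
- generalize (binomial_series lam x hlam); apply filter_imp; intros t Ht.
  replace (gen_fun lam 0 x t) with (Rpower (1 + lam * t) (x / lam)); [exact Ht|].
  unfold gen_fun; simpl; field.
- generalize (filter_and _ _ (IH (x + 1)) (IH x)); apply filter_imp.
  intros t [H1 H0]; rewrite (gen_fun_S _ _ _ _ hlam).
  apply is_pseries_ext with
    (PS_scal (/ INR (S k)) (PS_minus (egf (stirling2 lam k (x + 1)))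
                                     (egf (stirling2 lam k x)))).
  + intros n; unfold PS_scal, PS_minus, PS_plus, PS_opp, egf.
    change (stirling2 lam (S k) x n) with
      (/ INR (S k) * (stirling2 lam k (x + 1) n - stirling2 lam k x n)).
    change plus with Rplus; change opp with Ropp; change scal with Rmult.
    match goal with |- ?l = ?r => change (l = r :> R) end.
    field; split; [apply not_0_INR; lia|apply INR_fact_neq_0].
  + apply (is_pseries_scal (V := R_NormedModule)); [apply Rmult_comm|].
    now apply (is_pseries_minus (V := R_NormedModule)).
Qed.

(** * Identification of [S2] with the iterated differences *)

Lemma is_series_shift (c : nat -> R) (k : nat) (l : R) :
  (forall n, (n < k)%nat -> c n = 0) ->
  is_series (fun m => c (k + m)%nat) l <-> is_series c l.
Proof.
intros Hc; destruct k as [|k]; [reflexivity|].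
(* [sum_n c k] includes index [k], so it covers exactly the [S k] terms dropped by the shift. *)
assert (Hs : sum_n c k = 0).
{ rewrite (sum_n_ext_loc c (fun _ => 0)) by (intros n Hn; apply Hc; lia).
  rewrite sum_n_const; apply Rmult_0_r. }
split; intros H.
- apply (is_series_decr_n c (S k)); [lia|].
  change (is_series (fun m => c (S k + m)%nat) (l + - sum_n c k)).
  now rewrite Hs, Ropp_0, Rplus_0_r.
- apply (is_series_incr_n c (S k)); [lia|].
  change (is_series c (l + sum_n c k)).
  now rewrite Hs, Rplus_0_r.
Qed.

(** Since the coefficients below [k] vanish, the sum starting at [k] is a full power series, to
    which uniqueness of coefficients applies. *)
Lemma gen_fun_coeffs_egf (lam : R) (k : nat) (x : R) (a : nat -> R) :
  gen_fun_coeffs lam k x a <->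
  (forall n, (n < k)%nat -> a n = 0) /\
  locally 0 (fun t => is_pseries (egf a) t (gen_fun lam k x t)).
Proof.
assert (H : (forall n, (n < k)%nat -> a n = 0) -> forall t,
  is_series (fun m => a (k + m)%nat * (t ^ (k + m) / INR (fact (k + m))))
            (gen_fun lam k x t)
  <-> is_pseries (egf a) t (gen_fun lam k x t)).
{ intros Ha t; rewrite is_pseries_R.
  rewrite (is_series_shift (fun n => a n * (t ^ n / INR (fact n)))).
  - assert (Hn : forall n,
      a n * (t ^ n / INR (fact n)) = egf a n * t ^ n).
    { intros n; unfold egf; field; apply INR_fact_neq_0. }
    split; apply is_series_ext; intros n; [|symmetry]; apply Hn.
  - intros n Hn; rewrite (Ha n Hn); apply Rmult_0_l. }
split; intros [Ha Hl]; (split; [exact Ha|]);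
  revert Hl; apply filter_imp; intros t; apply (H Ha).
Qed.

(** The iterated differences witness existence, so the sequence chosen by [epsilon] also satisfies
    [gen_fun_coeffs]; uniqueness of power series coefficients makes the two agree. *)
Lemma S2_stirling2 (lam : R) (n k : nat) (x : R) : lam <> 0 ->
  S2 lam n k x = stirling2 lam k x n.
Proof.
intros hlam.
assert (Hex : gen_fun_coeffs lam k x (stirling2 lam k x)).
{ apply gen_fun_coeffs_egf; split.
  - intros m; apply stirling2_small.
  - now apply gen_fun_pseries. }
pose proof (epsilon_spec (inhabits (fun _ : nat => 0)) (gen_fun_coeffs lam k x)
  (ex_intro _ _ Hex)) as Hspec.
apply gen_fun_coeffs_egf in Hex; apply gen_fun_coeffs_egf in Hspec.
pose proof (locally_pseries_unique _ _ _ (proj2 Hspec) (proj2 Hex) n) as Heq.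
unfold egf in Heq; unfold S2.
exact (Rmult_eq_reg_r _ _ _ Heq (Rinv_neq_0_compat _ (INR_fact_neq_0 n))).
Qed.

Theorem theorem3 (lam x : R) (n k : nat) (hlam : lam <> 0)
  (hk : (1 <= k)%nat) (hkn : (k <= n)%nat) :
  S2 lam (n + 1) k x =
    (x + INR k) * S2 lam n k x + S2 lam n (k - 1) x - INR n * lam * S2 lam n k x.
Proof.
destruct k as [|k]; [lia|].
rewrite !S2_stirling2 by exact hlam.
rewrite Nat.add_1_r; simpl Nat.sub; rewrite Nat.sub_0_r, stirling2_rec.
ring.
Qed.
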